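(* Let $T=(t_{ij})\in\mathcal{A}_{1\to\infty}^{(n)}(\mathbb{C})$ with $\operatorname{rank}(T)=r$, and suppose that $t_{ii}=1$ for $1\le i\le m$ and $t_{ii}<1$ for $m+1\le i\le n$. Let $A=(a_{ij})\in M_n(\mathbb{C})$ be a unitary matrix with $T=A\Gamma A^*$, where $\Gamma=\operatorname{diag}(\lambda_1,\dots,\lambda_r,0,\dots,0)$ and $\lambda_1\ge\cdots\ge\lambda_r>0$ are the non-zero eigenvalues of $T$. Then the following are equivalent. (i) $T$ is an extreme contraction, i.e. an extreme point of $\mathcal{A}_{1\to\infty}^{(n)}(\mathbb{C})$. (ii) $\operatorname{rank}(L)=r^2$, where $L:V\to\mathbb{R}^m$ is the real-linear operator described in the context. (iii) $\operatorname{rank}(\tilde A)=r^2$, where $\tilde A=[P\ Q\ R]\in M_{m\times r^2}(\mathbb{R})$ with $P\in M_{m\times r}(\mathbb R)$ and $Q,R\in M_{m\times\frac{r(r-1)}{2}}(\mathbb R)$; the $s$-th column of $P$ is $(|a_{1s}|^2,\dots,|a_{ms}|^2)^T$ for $1\le s\le r$, and for $1\le p<l\le r$ the $(p,l)$-th columns of $Q$ and $R$ are $(2\Re\{a_{1p}\overline{a_{1l}}\},\dots,2\Re\{a_{mp}\overline{a_{ml}}\})^T$ and $(-2\Im\{a_{1p}\overline{a_{1l}}\},\dots,-2\Im\{a_{mp}\overline{a_{ml}}\})^T$ respectively.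
   Context: $\mathcal{A}_{1\to\infty}^{(n)}(\mathbb{C})=\{T\in M_n(\mathbb{C}):T\ge0,\ \|T\|_{\ell_1^n\to\ell_\infty^n}\le1\}$, where $T\ge 0$ means Hermitian non-negative definite and matrices act as operators with respect to the canonical basis. An extreme contraction is an extreme point of this convex set. $V$ is the real vector space of dimension $r^2$ of tuples $C'=(c_{jj},\Re(c_{pl}),\Im(c_{pl}))_{1\le j\le r,\ 1\le p<l\le r}$ with real entries (the coordinates of a Hermitian matrix $(c_{ij})\in M_r(\mathbb{C})$). The operator $L:V\to\mathbb{R}^m$ is $$L(C')_s=\sum_{p=1}^r|a_{sp}|^2c_{pp}+\sum_{1\le p<l\le r}\big[2\Re\{a_{sp}\overline{a_{sl}}\}\Re\{c_{pl}\}-2\Im\{a_{sp}\overline{a_{sl}}\}\Im\{c_{pl}\}\big],\qquad 1\le s\le m.$$ *)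

(* Defs.v *)
From HB Require Import structures.
From mathcomp Require Import all_boot all_order all_algebra.
From mathcomp Require Import classical_sets reals.
From mathcomp Require Export complex.

Set Implicit Arguments.
Unset Strict Implicit.
Unset Printing Implicit Defensive.

Import Order.TTheory GRing.Theory Num.Theory.

Local Open Scope ring_scope.
Local Open Scope classical_set_scope.
Local Open Scope complex_scope.
Local Open Scope sesquilinear_scope.

Section Contractions.
Variable R : realType.
Local Notation C := R[i].

Definition l1_norm n (x : 'cV[C]_n) : R := \sum_i Normc.normc (x i 0).

Definition linf_norm n (x : 'cV[C]_n) : R :=
  \big[Num.max/0]_i Normc.normc (x i 0).

(* Operator norm of T : l_1^n -> l_infty^n; the set below is nonempty and
   bounded above (opnorm_has_sup), so that [sup] is the actual supremum. *)
Definition opnorm_set n (T : 'M[C]_n) : set R :=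
  [set linf_norm (T *m x) | x in [set x : 'cV[C]_n | l1_norm x <= 1]].

Definition opnorm_1_infty n (T : 'M[C]_n) : R := sup (opnorm_set T).

(* [0 <= z] for [z : R[i]] means that z is a nonnegative real number. *)
Definition nonneg_definite n (T : 'M[C]_n) : Prop :=
  T \is hermsymmx /\ forall x : 'cV[C]_n, 0 <= (x^t* *m T *m x) 0 0.

Definition A_1_infty n : set 'M[C]_n :=
  [set T | nonneg_definite T /\ opnorm_1_infty T <= 1].

(* Convexity is with respect to real scalars, embedded in R[i] by [%:C]. *)
Definition extreme_point (V : lmodType C) (S : set V) (x : V) : Prop :=
  S x /\
  forall (y z : V) (t : R), S y -> S z -> 0 < t < 1 ->
    x = t%:C *: y + (1 - t)%:C *: z -> y = x /\ z = x.

Lemma opnorm_has_sup n (T : 'M[C]_n) : has_sup (opnorm_set T).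
Proof.
have n0 (z : C) : 0 <= Normc.normc z by case: z => a b; exact: sqrtr_ge0.
have nD (I : Type) (s : seq I) (F : I -> C) :
    Normc.normc (\sum_(i <- s) F i) <= \sum_(i <- s) Normc.normc (F i).
  elim: s => [|a s IH]; first by rewrite !big_nil Normc.normc0.
  by rewrite !big_cons (le_trans (le_normcD _ _))// lerD2l.
split.
  exists (linf_norm (T *m 0)); exists 0 => //=.
  by rewrite /l1_norm big1 ?ler01// => i _; rewrite mxE Normc.normc0.
exists (\sum_i \sum_j Normc.normc (T i j)) => _ [x /= x1 <-].
apply/bigmax_leP; split=> [|i _].
  by apply: sumr_ge0 => i _; apply: sumr_ge0.
rewrite mxE.
rewrite (le_trans (nD _ _ _))// [leRHS](bigD1 i)//= -[leLHS]addr0 lerD//.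
  apply: ler_sum => j _; rewrite Normc.normcM ler_piMr//.
  apply: le_trans x1; rewrite /l1_norm (bigD1 j)//= lerDl.
  exact: sumr_ge0.
by apply: sumr_ge0 => k _; apply: sumr_ge0.
Qed.

End Contractions.

Section OperatorL.
Variable R : realType.
Local Notation C := R[i].

Definition ltpair (r : nat) : finType := {pl : 'I_r * 'I_r | (pl.1 < pl.2)%N}.

(* C' = ((c_jj)_j, (Re c_pl)_(p<l), (Im c_pl)_(p<l)) *)
Definition hermcoord (r : nat) : vectType R :=
  ({ffun 'I_r -> R^o} * {ffun ltpair r -> R^o} * {ffun ltpair r -> R^o})%type.

(* In the next definitions B is the block (a_sp) (1 <= s <= m, 1 <= p <= r)
   of the unitary matrix A, cf. [topleft] below. *)
Definition L_fun m r (B : 'M[C]_(m, r)) (c : hermcoord r) : 'cV[R]_m :=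
  \col_s (\sum_(p < r) Normc.normc (B s p) ^+ 2 * c.1.1 p
    + \sum_(pl : ltpair r)
        (2 * complex.Re (B s (val pl).1 * (B s (val pl).2)^*) * c.1.2 pl
         - 2 * complex.Im (B s (val pl).1 * (B s (val pl).2)^*) * c.2 pl)).

Lemma L_fun_linear m r (B : 'M[C]_(m, r)) : linear (L_fun B).
Proof.
move=> k c d; apply/colP => s; rewrite !mxE mulrDr !mulr_sumr.
rewrite addrACA -!big_split/=; congr (_ + _); apply: eq_bigr => i _.
  by rewrite !ffunE mulrDr mulrCA.
by rewrite !ffunE !mulrDr opprD addrACA !mulrN !(mulrCA k).
Qed.

HB.instance Definition _ m r (B : 'M[C]_(m, r)) :=
  GRing.isLinear.Build R (hermcoord r) 'cV[R]_m _ (L_fun B) (L_fun_linear B).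

Definition L_op m r (B : 'M[C]_(m, r)) : 'Hom(hermcoord r, 'cV[R]_m) :=
  linfun (L_fun B).

Lemma L_opE m r (B : 'M[C]_(m, r)) c : L_op B c = L_fun B c.
Proof. by rewrite lfunE. Qed.

(* The columns of Q and R are indexed by the pairs p < l via [enum_val];
   the width of the matrix is r ^ 2 (A_tilde_width). *)
Definition A_tilde m r (B : 'M[C]_(m, r)) :
    'M[R]_(m, r + (#|ltpair r| + #|ltpair r|)) :=
  let pair k := val (enum_val k : ltpair r) in
  row_mx (\matrix_(s, p) Normc.normc (B s p) ^+ 2)
    (row_mx
      (\matrix_(s, k) (2 * complex.Re (B s (pair k).1 * (B s (pair k).2)^*)))
      (\matrix_(s, k) - (2 * complex.Im (B s (pair k).1 * (B s (pair k).2)^*)))).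

Lemma card_ltpair r : #|ltpair r| = 'C(r, 2).
Proof.
rewrite card_sig -sum1_card.
under eq_bigl do rewrite inE.
rewrite -(pair_big_dep xpredT (fun p l : 'I_r => (p < l)%N) (fun _ _ => 1%N))/=.
rewrite (exchange_big_dep xpredT)//= -bin2_sum big_mkord.
apply: eq_bigr => i _.
by rewrite -(big_ord_widen_cond r xpredT (fun=> 1%N) (ltnW (ltn_ord i))) sum1_card card_ord.
Qed.

Lemma A_tilde_width r : (r + (#|ltpair r| + #|ltpair r|) = r ^ 2)%N.
Proof.
rewrite card_ltpair addnn bin2 -mul2n mul2n halfK.
rewrite oddM; case: r => //= r; rewrite andNb subn0.
by rewrite -mulnS.
Qed.

Lemma dim_hermcoord r : \dim {: hermcoord r} = (r ^ 2)%N.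
Proof.
rewrite -(A_tilde_width r) dimvf addnA.
by rewrite -[RHS]muln1 !mulnDl -{1}[r in RHS]card_ord.
Qed.

End OperatorL.

Definition topleft (K : Type) n m r (hm : (m <= n)%N) (hr : (r <= n)%N)
    (A : 'M[K]_n) : 'M[K]_(m, r) :=
  \matrix_(s, p) A (widen_ord hm s) (widen_ord hr p).

(* Main.v *)
Require Import Defs.
From mathcomp Require Import all_boot all_order all_algebra.
From mathcomp Require Import classical_sets reals.
From mathcomp Require Import ring lra.

Set Implicit Arguments.
Unset Strict Implicit.
Unset Printing Implicit Defensive.

Import Order.TTheory GRing.Theory Num.Theory.

Local Open Scope ring_scope.
Local Open Scope classical_set_scope.
Local Open Scope complex_scope.
Local Open Scope sesquilinear_scope.

(** A nonnegative definite [T] is a contraction from l_1 to l_infty iff its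
    diagonal entries are at most 1.  Let [B] consist of the first [r] columns of
    [A], so that [B] is an isometry onto the range of [T].  The diagonal of
    [B H B^*], for [H] Hermitian with coordinates [c], is [L c].  If [L c = 0]
    with [c <> 0], then [T + e B H B^*] and [T - e B H B^*] are contractions for
    small [e > 0], because [T] is positive definite on its range and its
    remaining diagonal entries are less than 1; so [T] is not extreme.
    Conversely, if [T = t Y + (1 - t) Z], then [Y] and [Z] vanish on the kernel
    of [T] and have diagonal entries 1 wherever [T] does, so [Y - T = B H B^*]
    with [L c = 0], and injectivity of [L] gives [Y = T]. *)

(** * Hermitian forms and nonnegative definite matrices *)

Section HermitianForms.
Variable R : realType.
Local Notation C := R[i].

Lemma adjmxM m n p (M : 'M[C]_(m, n)) (N : 'M[C]_(n, p)) :
  (M *m N)^t* = N^t* *m M^t*.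
Proof. by rewrite trmx_mul map_mxM. Qed.

Lemma adjmxD m n (M N : 'M[C]_(m, n)) : (M + N)^t* = M^t* + N^t*.
Proof. by rewrite linearD map_mxD. Qed.

Lemma adjmxN m n (M : 'M[C]_(m, n)) : (- M)^t* = - M^t*.
Proof. by rewrite linearN map_mxN. Qed.

Lemma adjmxZ m n (a : C) (M : 'M[C]_(m, n)) :
  (a *: M)^t* = (Num.conj a) *: M^t*.
Proof. by rewrite linearZ map_mxZ. Qed.

Lemma hermsymmxP n (M : 'M[C]_n) : reflect (M^t* = M) (M \is hermsymmx).
Proof.
apply: (iffP (is_hermitianmxP _ _ _)); rewrite expr0 scale1r; exact: esym.
Qed.

Definition form n (M : 'M[C]_n) (x y : 'cV[C]_n) : C :=
  (x^t* *m M *m y) 0 0.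

Lemma formE n (M : 'M[C]_n) x y :
  form M x y = \sum_i \sum_j Num.conj (x i 0) * M i j * y j 0.
Proof.
rewrite /form mxE exchange_big; apply: eq_bigr => j _.
by rewrite !mxE mulr_suml; apply: eq_bigr => i _; rewrite !mxE.
Qed.

Lemma formDl n (M N : 'M[C]_n) x y : form (M + N) x y = form M x y + form N x y.
Proof. by rewrite /form mulmxDr mulmxDl mxE. Qed.

Lemma formZl n a (M : 'M[C]_n) x y : form (a *: M) x y = a * form M x y.
Proof. by rewrite /form -scalemxAr -scalemxAl mxE. Qed.

Lemma formZr n a (M : 'M[C]_n) x y : form M x (a *: y) = a * form M x y.
Proof. by rewrite /form -scalemxAr mxE. Qed.

Lemma formBl n (M : 'M[C]_n) x y z : form M (x - y) z = form M x z - form M y z.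
Proof. by rewrite /form adjmxD adjmxN !mulmxBl mxE [X in _ + X]mxE. Qed.

Lemma formBr n (M : 'M[C]_n) x y z : form M x (y - z) = form M x y - form M x z.
Proof. by rewrite /form mulmxBr mxE [X in _ + X]mxE. Qed.

Lemma formZ n a (M : 'M[C]_n) x : form M (a *: x) (a *: x) = `|a| ^+ 2 * form M x x.
Proof.
by rewrite formZr /form adjmxZ -!scalemxAl mxE mulrA normCK.
Qed.

Lemma form_ge0 n (M : 'M[C]_n) x : nonneg_definite M -> 0 <= form M x x.
Proof. by move=> [_]; apply. Qed.

Lemma form_deltal n (M : 'M[C]_n) i x : form M (delta_mx i 0) x = (M *m x) i 0.
Proof.
by rewrite /form trmx_delta map_delta_mx -mulmxA -rowE mxE.
Qed.

Lemma form_delta n (M : 'M[C]_n) i j : form M (delta_mx i 0) (delta_mx j 0) = M i j.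
Proof. by rewrite form_deltal -colE mxE. Qed.

Lemma form_conj n (M : 'M[C]_n) x y : M \is hermsymmx ->
  form M y x = Num.conj (form M x y).
Proof.
move=> /hermsymmxP hM.
have -> : Num.conj (form M x y) = ((x^t* *m M *m y)^t*) 0 0.
  by rewrite [RHS]mxE [in RHS]mxE.
by rewrite !adjmxM hM trmxCK mulmxA.
Qed.

Lemma form_congr n r (B : 'M[C]_(n, r)) (M : 'M[C]_r) x y :
  form (B *m M *m B^t*) x y = form M (B^t* *m x) (B^t* *m y).
Proof. by rewrite /form adjmxM trmxCK !mulmxA. Qed.

Lemma hermsymmx_congr n r (B : 'M[C]_(n, r)) (M : 'M[C]_r) :
  M \is hermsymmx -> B *m M *m B^t* \is hermsymmx.
Proof.
by move=> /hermsymmxP hM; apply/hermsymmxP; rewrite !adjmxM hM trmxCK mulmxA.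
Qed.

Lemma nonneg_definite_congr n r (B : 'M[C]_(n, r)) (M : 'M[C]_r) :
  nonneg_definite M -> nonneg_definite (B *m M *m B^t*).
Proof.
move=> [hM M0]; split=> [|x]; first exact: hermsymmx_congr.
by rewrite -/(form _ _ _) form_congr; exact: M0.
Qed.

(** Expand [0 <= form M (x - y) (x - y)]. This replaces the Cauchy-Schwarz inequality below: one
    argument is rescaled so that the cross term becomes a chosen nonnegative real. *)
Lemma nonneg_form_le n (M : 'M[C]_n) x y : nonneg_definite M ->
  form M x y + Num.conj (form M x y) <= form M x x + form M y y.
Proof.
move=> hM; have := form_ge0 (x - y) hM; rewrite -(form_conj x y (proj1 hM)).
have -> : form M (x - y) (x - y) =
    form M x x + form M y y - (form M x y + form M y x).
  by rewrite formBl !formBr opprB addrACA -opprD.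
by rewrite subr_ge0.
Qed.

Lemma nonneg_form_eq0 n (M : 'M[C]_n) x : nonneg_definite M ->
  form M x x = 0 -> M *m x = 0.
Proof.
move=> hM x0; apply/colP => i; rewrite [RHS]mxE -form_deltal.
(* The cross term can be made larger than [form M y y] by rescaling [x]. *)
set y := delta_mx i 0; apply/eqP/negP => /negP a0.
have b0 := form_ge0 y hM.
have := nonneg_form_le y (((form M y y + 1) / form M y x) *: x) hM.
rewrite formZr formZ x0 mulr0 addr0 divfK//.
have s1 : 0 <= form M y y + 1 by rewrite addr_ge0 ?ler01.
rewrite (CrealP (ger0_real s1)).
by rewrite lt_geF// -addrA ltrDl addr_gt0// ltr_wpDl.
Qed.

(** A Gershgorin-type bound: [form M x x] is real and at most the weighted sum of the [l i] in
    absolute value, because [2 |x_i| |x_j| <= |x_i|^2 + |x_j|^2]. The row sums include the diagonal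
    of [M]. *)
Lemma nonneg_diag_dominant n (l : 'I_n -> R) (M : 'M[C]_n) : M \is hermsymmx ->
  (forall i, \sum_j Normc.normc (M i j) <= l i) ->
  nonneg_definite (diag_mx (\row_i (l i)%:C) + M).
Proof.
move=> hM Ml; split=> [|x].
  apply/hermsymmxP; rewrite adjmxD (hermsymmxP _ hM); congr (_ + _).
  rewrite tr_diag_mx map_diag_mx; congr diag_mx; apply/rowP => i.
  by rewrite !mxE; exact: conjc_real.
rewrite -/(form _ _ _) formDl.
have Mreal : form M x x \is Num.real by apply/CrealP; rewrite -form_conj.
have -> : form (diag_mx (\row_i (l i)%:C)) x x = \sum_i (l i)%:C * `|x i 0| ^+ 2.
  rewrite formE; apply: eq_bigr => i _; rewrite (bigD1 i)//= big1 => [|j ji].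
    by rewrite !mxE eqxx mulr1n addr0 normCK; ring.
  by rewrite !mxE eq_sym (negbTE ji) mulr0n mulr0 mul0r.
suff : `|form M x x| <= \sum_i (l i)%:C * `|x i 0| ^+ 2.
  by rewrite real_ler_norml// => /andP[+ _]; rewrite -subr_ge0 opprK addrC.
have Msym i j : `|M i j| = `|M j i|.
  by have /matrixP/(_ i j) := hermsymmxP _ hM; rewrite !mxE => <-; rewrite norm_conjC.
apply: (@le_trans _ _ (\sum_i \sum_j `|M i j| * `|x i 0| ^+ 2)); last first.
  apply: ler_sum => i _; rewrite -mulr_suml ler_wpM2r ?exprn_ge0//.
  by have := Ml i; rewrite -lecR rmorph_sum.
(* Average the double sum with its transpose, using the symmetry of [|M i j|]. *)
have half : \sum_i \sum_j `|M i j| * `|x i 0| ^+ 2 =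
    \sum_i \sum_j `|M i j| * ((`|x i 0| ^+ 2 + `|x j 0| ^+ 2) / 2).
  have n2 : 2 != 0 :> C by rewrite pnatr_eq0.
  rewrite -[LHS](mulfK n2) mulr_natr mulr2n {2}exchange_big -big_split mulr_suml.
  apply: eq_bigr => i _; rewrite -big_split mulr_suml.
  by apply: eq_bigr => j _; rewrite /= (Msym j i); ring.
rewrite half formE; apply: le_trans (ler_norm_sum _ _ _) _.
apply: ler_sum => i _; apply: le_trans (ler_norm_sum _ _ _) _.
apply: ler_sum => j _; rewrite !normrM norm_conjC -mulrA mulrCA.
rewrite ler_wpM2l// ler_pdivlMr// -subr_ge0.
have -> : `|x i 0| ^+ 2 + `|x j 0| ^+ 2 - `|x i 0| * `|x j 0| * 2 =
  (`|x i 0| - `|x j 0|) ^+ 2 by ring.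
by rewrite real_exprn_even_ge0// realB ?normr_real.
Qed.

End HermitianForms.

(** * Contractions in terms of diagonal entries *)

Section Contraction.
Variable R : realType.
Local Notation C := R[i].

Lemma nonneg_entry_le1 n (T : 'M[C]_n) i j : nonneg_definite T ->
  (forall i, T i i <= 1) -> `|T i j| <= 1.
Proof.
move=> hT T1; have [->|T0] := eqVneq (T i j) 0; first by rewrite normr0.
(* This phase rotates the second basis vector so that the cross term is exactly [|T i j|]; the
   inequality then reads [2 |T i j| <= T i i + T j j]. *)
have u1 : `|(`|T i j| / T i j)| = 1.
  by rewrite normrM normrV ?unitfE// normr_id divff// normr_eq0.
have := nonneg_form_le (delta_mx i 0) ((`|T i j| / T i j) *: delta_mx j 0) hT.
rewrite formZr formZ u1 expr1n mul1r !form_delta divfK//.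
rewrite (CrealP (normr_real _)) => H.
have : `|T i j| + `|T i j| <= 1 + 1 by apply: le_trans H _; rewrite lerD.
by rewrite -!mulr2n lerMn2r.
Qed.

(** Basis vectors have l_1 norm 1, so a norm bound controls the diagonal. Conversely, positivity
    carries the diagonal bound over to all entries, and these bound the norm. *)
Lemma A_1_inftyE n (T : 'M[C]_n) :
  A_1_infty T <-> nonneg_definite T /\ forall i, T i i <= 1.
Proof.
have n0 (z : C) : 0 <= Normc.normc z by case: z => a b; exact: sqrtr_ge0.
split=> -[hT T1]; split => //.
  move=> i; have Ti0 : 0 <= T i i by rewrite -form_delta form_ge0.
  rewrite -(ger0_norm Ti0) -[leLHS]/(Normc.normc (T i i))%:C.
  rewrite -[1]/(1%:C) lecR; apply: le_trans T1.
  apply: (@le_trans _ _ (linf_norm (T *m delta_mx i 0))).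
    by rewrite /linf_norm -colE; have := le_bigmax 0 (fun k => Normc.normc (col i T k 0)) i; rewrite mxE.
  apply: ub_le_sup; first by case: (opnorm_has_sup T).
  exists (delta_mx i 0) => //=; rewrite /l1_norm (bigD1 i)//= big1 => [|k ki].
    by rewrite mxE !eqxx addr0 Normc.normc1.
  by rewrite mxE (negbTE ki) Normc.normc0.
apply: ge_sup; first by case: (opnorm_has_sup T).
move=> _ [x /= x1 <-]; apply/bigmax_leP; split => // i _.
rewrite -lecR -[leLHS]/(`|(T *m x) i 0|) mxE.
apply: le_trans (ler_norm_sum _ _ _) _.
apply: (@le_trans _ _ (l1_norm x)%:C); last by rewrite lecR.
rewrite /l1_norm rmorph_sum; apply: ler_sum => j _.
by rewrite normrM -[leRHS]mul1r ler_wpM2r// nonneg_entry_le1.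
Qed.

End Contraction.

(** * Real coordinates of Hermitian matrices *)

Section HermitianCoordinates.
Variable R : realType.
Local Notation C := R[i].

(** [insub] tests whether a pair of indices is strictly increasing; both tests fail exactly on the
    diagonal. *)
Definition hermmx r (c : hermcoord R r) : 'M[C]_r := \matrix_(i, j)
  match insub (i, j) : option (ltpair r), insub (j, i) : option (ltpair r) with
  | Some pl, _ => c.1.2 pl +i* c.2 pl
  | None, Some lp => c.1.2 lp -i* c.2 lp
  | None, None => (c.1.1 i)%:C
  end.

Definition coord_of_mx r (M : 'M[C]_r) : hermcoord R r :=
  ([ffun i => complex.Re (M i i)],
   [ffun pl => complex.Re (M (val pl).1 (val pl).2)],
   [ffun pl => complex.Im (M (val pl).1 (val pl).2)]).

Lemma hermmx_diag r (c : hermcoord R r) i : hermmx c i i = (c.1.1 i)%:C.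
Proof. by rewrite mxE insubN//= ltnn. Qed.

Lemma hermmx_lt r (c : hermcoord R r) (pl : ltpair r) :
  hermmx c (val pl).1 (val pl).2 = c.1.2 pl +i* c.2 pl.
Proof. by rewrite mxE -surjective_pairing valK. Qed.

Lemma hermmx_gt r (c : hermcoord R r) (pl : ltpair r) :
  hermmx c (val pl).2 (val pl).1 = c.1.2 pl -i* c.2 pl.
Proof.
rewrite mxE insubN; last by rewrite -leqNgt ltnW// (valP pl).
by rewrite -surjective_pairing valK.
Qed.

Lemma ord_pairP r (P : 'I_r -> 'I_r -> Prop) : (forall i, P i i) ->
  (forall pl : ltpair r, P (val pl).1 (val pl).2) ->
  (forall pl : ltpair r, P (val pl).2 (val pl).1) -> forall i j, P i j.
Proof.
move=> Pd Plt Pgt i j; have [ij|ji|/val_inj->//] := ltngtP i j.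
  exact: (Plt (exist _ (i, j) ij)).
exact: (Pgt (exist _ (j, i) ji)).
Qed.

Lemma hermmx_herm r (c : hermcoord R r) : hermmx c \is hermsymmx.
Proof.
apply/hermsymmxP/matrixP; apply: ord_pairP => [i|pl|pl]; rewrite [LHS]mxE [in LHS]mxE.
- by rewrite hermmx_diag; exact: conjc_real.
- by rewrite hermmx_lt hermmx_gt; rewrite -[LHS]/(conjc _)/= opprK.
- by rewrite hermmx_lt hermmx_gt.
Qed.

Lemma hermmxK r (c : hermcoord R r) : coord_of_mx (hermmx c) = c.
Proof.
case: c => [[a b] d]; congr (_, _, _); apply/ffunP => x; rewrite ffunE.
- by rewrite hermmx_diag.
- by rewrite hermmx_lt.
- by rewrite hermmx_lt.
Qed.

Lemma coord_of_mxK r (M : 'M[C]_r) : M \is hermsymmx ->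
  hermmx (coord_of_mx M) = M.
Proof.
move=> /hermsymmxP/matrixP hM.
apply/matrixP; apply: ord_pairP => [i|pl|pl].
- rewrite hermmx_diag ffunE; have := hM i i; rewrite !mxE => /CrealP.
  exact: RRe_real.
- by rewrite hermmx_lt !ffunE; case: (M _ _).
- rewrite hermmx_gt !ffunE -(hM (val pl).2) !mxE.
  by case: (M _ _).
Qed.

Lemma hermmx0 r : hermmx (0 : hermcoord R r) = 0.
Proof.
by apply/matrixP; apply: ord_pairP => [i|pl|pl];
  rewrite ?(hermmx_diag, hermmx_lt, hermmx_gt) /= !ffunE mxE ?oppr0.
Qed.

Lemma hermmx_eq0 r (c : hermcoord R r) : hermmx c = 0 -> c = 0.
Proof. by move=> c0; rewrite -(hermmxK c) c0 -hermmx0 hermmxK. Qed.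

Lemma sum_ltpair (V : nmodType) r (F : 'I_r -> 'I_r -> V) :
  \sum_i \sum_j F i j = \sum_i F i i +
    \sum_(pl : ltpair r) (F (val pl).1 (val pl).2 + F (val pl).2 (val pl).1).
Proof.
rewrite big_split pair_bigA /=.
have subE (G : 'I_r * 'I_r -> V) :
    \sum_(pl : ltpair r) G (val pl) = \sum_(p : 'I_r * 'I_r | (p.1 < p.2)%N) G p.
  by rewrite -(big_sub (fun p : 'I_r * 'I_r => (p.1 < p.2)%N)).
rewrite (subE (fun p => F p.1 p.2)) (subE (fun p => F p.2 p.1)).
rewrite (bigID (fun p : 'I_r * 'I_r => (p.1 < p.2)%N)) /= addrCA; congr (_ + _).
rewrite (bigID (fun p : 'I_r * 'I_r => (p.2 < p.1)%N)) /= addrC; congr (_ + _).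
  (* Pairs increasing in neither order form the diagonal. *)
  rewrite (reindex_omap (fun i => (i, i)) (fun p => Some p.1)) => [|[i j]] /=.
    by apply: eq_bigl => i; rewrite ltnn eqxx.
  by rewrite -!leqNgt -eqn_leq => /eqP/val_inj ->.
(* Swapping the indices carries the lower triangle to the upper one. *)
rewrite (reindex_inj (h := fun p => (p.2, p.1))) => [|[i j] [k l] [-> ->]]//=.
by apply: eq_bigl => p; rewrite andb_idl// -leqNgt; exact: ltnW.
Qed.

(** The origin of the formula for [L]: the terms at (p, l) and (l, p) are conjugate, and expanding
    twice the real part of a product gives the factors 2 and the minus sign. *)
Lemma diag_congr_hermmx m r (B : 'M[C]_(m, r)) c s :
  (B *m hermmx c *m B^t*) s s = (L_fun B c s 0)%:C.
Proof.
have -> : (B *m hermmx c *m B^t*) s s =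
    \sum_i \sum_j B s i * hermmx c i j * Num.conj (B s j).
  rewrite mxE exchange_big; apply: eq_bigr => j _.
  by rewrite !mxE mulr_suml.
rewrite sum_ltpair mxE rmorphD !rmorph_sum; congr (_ + _); apply: eq_bigr => i _.
  rewrite hermmx_diag rmorphM/= rmorphXn/= -[(Normc.normc _)%:C]/(`|B s i|) normCK.
  ring.
rewrite hermmx_lt hermmx_gt; case: (B s _) (B s _) => a1 b1 [a2 b2].
by apply/eqP; rewrite eq_complex /=; apply/andP; split; apply/eqP; ring.
Qed.

End HermitianCoordinates.

(** * Perturbations and convex decompositions of a contraction *)

Section ContractionPerturbation.
Variable R : realType.
Local Notation C := R[i].

Lemma uniform_scale (I : finType) (a b : I -> R) :
  (forall i, 0 <= a i) -> (forall i, 0 < b i) ->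
  exists2 e : R, 0 < e & forall i, e * a i <= b i.
Proof.
(* The sum dominates each ratio [a i / b i]; the added 1 keeps [S] positive even if all ratios
   vanish. *)
move=> a0 b0; set S := 1 + \sum_i a i / b i.
have ab0 i : 0 <= a i / b i by rewrite divr_ge0// ltW.
have S0 : 0 < S by rewrite ltr_pwDl// sumr_ge0.
exists S^-1 => [|i]; first by rewrite invr_gt0.
rewrite mulrC ler_pdivrMr// mulrC -ler_pdivrMr// /S (bigD1 i)//= addrCA lerDl.
by rewrite addr_ge0// sumr_ge0.
Qed.

Variables (n m r : nat) (T : 'M[C]_n) (B : 'M[C]_(n, r)) (l : 'I_r -> R).
Hypothesis T_tight : forall i : 'I_n, (i < m)%N -> T i i = 1.
Hypothesis T_slack : forall i : 'I_n, (m <= i)%N -> T i i < 1.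
Hypothesis B_isometry : B^t* *m B = 1%:M.
Hypothesis l_gt0 : forall k, 0 < l k.
Hypothesis T_spectral : T = B *m diag_mx (\row_k (l k)%:C) *m B^t*.

Lemma A_1_infty_perturb (c : hermcoord R r) :
  (forall i : 'I_n, (i < m)%N -> L_fun B c i 0 = 0) ->
  exists2 e : R, 0 < e & forall d, `|d| <= e ->
    A_1_infty (T + d%:C *: (B *m hermmx c *m B^t*)).
Proof.
move=> Lc0.
(* One scale has to meet two families of constraints: row sums of [hermmx c] against the
   eigenvalues, and diagonal changes against the slack of [T]. At tight indices the change is 0, so
   the bound 1 there is only a positive placeholder. *)
pose a (i : 'I_r + 'I_n) := match i with
  | inl k => \sum_j Normc.normc (hermmx c k j)
  | inr i => `|L_fun B c i 0| end.
pose b (i : 'I_r + 'I_n) := match i with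
  | inl k => l k
  | inr i => if (i < m)%N then 1 else 1 - complex.Re (T i i) end.
have [|[k|i]|e e0 He] := @uniform_scale _ a b.
- case=> [k|i] /=; last exact: normr_ge0.
  by apply: sumr_ge0 => j _; case: (hermmx c k j) => x y; exact: sqrtr_ge0.
- exact: l_gt0.
- rewrite /b; case: ltnP => // /T_slack; rewrite ltcE subr_gt0 => /andP[_].
  exact.
exists e => // d de; apply/A_1_inftyE; split=> [|i].
  (* The perturbed matrix is a congruence by [B] of the eigenvalue matrix plus [d] times [hermmx c],
     so diagonal dominance in size [r] suffices. *)
  rewrite T_spectral scalemxAl scalemxAr -mulmxDl -mulmxDr.
  apply: nonneg_definite_congr; apply: nonneg_diag_dominant => [|k].
    apply/hermsymmxP; rewrite adjmxZ (hermsymmxP _ (hermmx_herm c)).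
    by congr (_ *: _); exact: conjc_real.
  apply: le_trans (He (inl k)); rewrite mulr_sumr; apply: ler_sum => j _.
  rewrite mxE Normc.normcM ler_wpM2r//.
    by case: (hermmx c k j) => x y; exact: sqrtr_ge0.
  by rewrite /= expr0n addr0 sqrtr_sqr.
rewrite mxE [X in _ + X]mxE diag_congr_hermmx -rmorphM.
have [im|mi] := ltnP i m; first by rewrite Lc0// mulr0 addr0 T_tight.
have := T_slack mi; have := He (inr i); rewrite /= ltnNge mi /=.
case: (T i i) => x y eL; rewrite ltcE lecE /= => /andP[/eqP <- _].
rewrite addr0 eqxx /= -lerBrDl; apply: le_trans eL.
apply: le_trans (ler_norm _) _; rewrite normrM.
by rewrite ler_wpM2r.
Qed.

Lemma extreme_point_L_inj (c : hermcoord R r) : extreme_point (@A_1_infty R n) T ->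
  (forall i : 'I_n, (i < m)%N -> L_fun B c i 0 = 0) -> c = 0.
Proof.
move=> [_ ext] /A_1_infty_perturb[e e0 He]; apply: hermmx_eq0.
set D := B *m _ *m _ in He.
suff D0 : D = 0.
  (* The isometry [B] lets [hermmx c] be recovered from [D]. *)
  transitivity (B^t* *m D *m B); last by rewrite D0 mulmx0 mul0mx.
  by rewrite !mulmxA B_isometry mul1mx -mulmxA B_isometry mulmx1.
(* [T] is the midpoint of its perturbations by [e] and [- e]. *)
have half : 0 < (2^-1 : R) < 1 by rewrite invr_gt0 invf_lt1 ?ltr0n ?ltr1n.
have [|||+ _] := ext _ _ _ (He e _) (He (- e) _) half.
- by rewrite gtr0_norm.
- by rewrite normrN gtr0_norm.
- have -> : 1 - 2^-1 = 2^-1 :> R by lra.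
  rewrite -scalerDr addrACA -scalerDl rmorphN subrr scale0r addr0 scalerDr -scalerDl.
  by rewrite -rmorphD -[2^-1]div1r -splitr scale1r.
move/eqP; rewrite -subr_eq0 addrAC subrr add0r scaler_eq0 => /orP[|/eqP//].
by rewrite (inj_eq (@complexI R) e 0) gt_eqF.
Qed.

Lemma L_inj_convex_eq (Y Z : 'M[C]_n) (t : R) :
  (forall c : hermcoord R r,
    (forall i : 'I_n, (i < m)%N -> L_fun B c i 0 = 0) -> c = 0) ->
  A_1_infty Y -> A_1_infty Z -> 0 < t < 1 ->
  T = t%:C *: Y + (1 - t)%:C *: Z -> Y = T.
Proof.
move=> Linj /A_1_inftyE[Ypos Y1] /A_1_inftyE[Zpos Z1] /andP[t0 t1] TE.
have tC0 : 0 < t%:C by rewrite ltcR.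
have sC0 : 0 < (1 - t)%:C by rewrite ltcR subr_gt0.
(* A convex decomposition of [T] cannot enlarge the range of [T]. *)
have YB : Y *m (B *m B^t*) = Y.
  apply/eqP; rewrite eq_sym -subr_eq0 -{1}[Y]mulmx1 -mulmxBr; apply/eqP.
  apply/matrixP => i j; rewrite [RHS]mxE.
  (* [Q] projects onto the orthogonal complement of the range of [B]. There the form of [T]
     vanishes, and it is a positive combination of the nonnegative forms of [Y] and [Z], so that of
     [Y] vanishes too. *)
  set Q := 1%:M - _.
  have colM (N : 'M[C]_n) : N *m col j Q = col j (N *m Q) by rewrite !colE mulmxA.
  suff : Y *m col j Q = 0.
    by rewrite colM => /colP/(_ i); rewrite !mxE.
  apply: nonneg_form_eq0 => //.
  have TQ : T *m Q = 0.
    rewrite T_spectral mulmxBr mulmx1 [X in _ - X]mulmxA -[X in _ - X *m _]mulmxA.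
    by rewrite B_isometry mulmx1 subrr.
  have : form T (col j Q) (col j Q) = 0.
    by rewrite /form -mulmxA colM TQ !mxE big1// => k _; rewrite !mxE mulr0.
  have Yq := form_ge0 (col j Q) Ypos; have Zq := form_ge0 (col j Q) Zpos.
  rewrite TE formDl !formZl => /eqP; rewrite paddr_eq0 ?mulr_ge0// 1?ltW//.
  by rewrite !mulf_eq0 gt_eqF//= => /andP[/eqP].
have BY : B *m B^t* *m Y = Y.
  by rewrite -{2}(hermsymmxP _ (proj1 Ypos)) -{2}YB !adjmxM trmxCK (hermsymmxP _ (proj1 Ypos)).
(* The compression of [Y - T] to the range of [B]; nothing is lost, since [Y] and [T] both live on
   that range. *)
pose M := B^t* *m Y *m B - diag_mx (\row_k (l k)%:C).
have Mherm : M \is hermsymmx.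
  apply/hermsymmxP; rewrite adjmxD adjmxN !adjmxM trmxCK mulmxA.
  rewrite (hermsymmxP _ (proj1 Ypos)) tr_diag_mx map_diag_mx; congr (_ - diag_mx _).
  by apply/rowP => k; rewrite !mxE; exact: conjc_real.
have DE : B *m M *m B^t* = Y - T.
  rewrite mulmxBr mulmxBl -T_spectral; congr (_ - _).
  by rewrite !mulmxA BY -mulmxA YB.
have M0 : coord_of_mx M = 0.
  apply: Linj => i im; apply: (@complexI R); rewrite -diag_congr_hermmx.
  rewrite coord_of_mxK// DE mxE [X in _ + X]mxE.
  apply/eqP; rewrite subr_eq0 T_tight//.
  (* A proper convex combination of two numbers at most 1 equals 1 only if both do. *)
  have := T_tight im; rewrite {1}TE !mxE => TE1.
  rewrite eq_le Y1 -(ler_pM2l tC0) mulr1 -(lerD2r ((1 - t)%:C * Z i i)) TE1.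
  have -> : 1 = t%:C + (1 - t)%:C * 1 by rewrite mulr1 -rmorphD addrC subrK.
  by rewrite lerD2l ler_wpM2l// ltW.
by apply/eqP; rewrite -subr_eq0 -DE -(coord_of_mxK Mherm) M0 hermmx0 mulmx0 mul0mx.
Qed.

End ContractionPerturbation.

(** * Rank conditions as injectivity of [L] *)

Section Ranks.
Variable R : realType.
Local Notation C := R[i].

Lemma rank_colP (F : fieldType) p q (M : 'M[F]_(p, q)) :
  \rank M = q <-> forall x : 'cV_q, M *m x = 0 -> x = 0.
Proof.
split=> [rM x Mx|inj].
  have fM : row_free M^T by rewrite /row_free mxrank_tr rM.
  apply: trmx_inj; rewrite trmx0; apply/eqP.
  by rewrite -(mulmx_free_eq0 _ fM) -trmx_mul Mx trmx0.
apply/eqP; rewrite -mxrank_tr; apply: inj_row_free => v vM.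
apply: trmx_inj; rewrite trmx0; apply: inj.
by rewrite -[M]trmxK -trmx_mul vM trmx0.
Qed.

(** Rank-nullity. *)
Lemma dim_limgP (V W : vectType R) (f : 'Hom(V, W)) :
  \dim (limg f) = \dim {: V} <-> forall v, f v = 0 -> v = 0.
Proof.
have dimE := limg_ker_dim f fullv; rewrite capfv in dimE.
split=> [E v fv|inj].
  have : lker f == 0%VS.
    by rewrite -dimv_eq0 -(eqn_add2r (\dim (limg f))) dimE E.
  by move/lker0P; apply; rewrite fv linear0.
have k0 : lker f = 0%VS.
  apply/eqP; rewrite -subv0; apply/subvP => v; rewrite memv_ker memv0 => /eqP fv.
  by rewrite (inj v).
by rewrite -dimE k0 dimv0.
Qed.

(** The blocks follow the column order of [A_tilde], which makes [A_tilde B] the matrix of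
    [L_fun B]. *)
Definition col_of_coord r (c : hermcoord R r) : 'cV[R]_(r + (#|ltpair r| + #|ltpair r|)) :=
  col_mx (\col_p c.1.1 p)
    (col_mx (\col_k c.1.2 (enum_val k)) (\col_k c.2 (enum_val k))).

Lemma A_tilde_mul m r (B : 'M[C]_(m, r)) c : A_tilde B *m col_of_coord c = L_fun B c.
Proof.
rewrite !mul_row_col; apply/colP => s; rewrite !mxE.
congr (_ + _); first by apply: eq_bigr => p _; rewrite !mxE.
rewrite -big_split (reindex _ (onW_bij _ (enum_val_bij (ltpair r)))) /=.
by apply: eq_bigr => k _; rewrite !mxE mulNr.
Qed.

Lemma col_of_coord_surj r x : exists c : hermcoord R r, col_of_coord c = x.
Proof.
exists ([ffun p => usubmx x p 0], [ffun pl => usubmx (dsubmx x) (enum_rank pl) 0],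
  [ffun pl => dsubmx (dsubmx x) (enum_rank pl) 0]).
rewrite -[RHS]vsubmxK -[dsubmx x in RHS]vsubmxK; congr col_mx; last congr col_mx.
all: by apply/colP => k; rewrite mxE ffunE ?enum_valK.
Qed.

Lemma col_of_coord_eq0 r (c : hermcoord R r) : col_of_coord c = 0 -> c = 0.
Proof.
move=> /eqP; rewrite !col_mx_eq0 => /and3P[/eqP/colP a0 /eqP/colP b0 /eqP/colP d0].
case: c a0 b0 d0 => [[a b] d] /= a0 b0 d0; congr (_, _, _); apply/ffunP => x.
- by have := a0 x; rewrite !mxE ffunE.
- by have := b0 (enum_rank x); rewrite !mxE enum_rankK ffunE.
- by have := d0 (enum_rank x); rewrite !mxE enum_rankK ffunE.
Qed.

(** The domain has dimension [r ^ 2], so full rank is injectivity. This is the common condition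
    through which both ranks are compared with extremality. *)
Lemma dim_limg_L_opP m r (B : 'M[C]_(m, r)) :
  \dim (limg (L_op B)) = (r ^ 2)%N <-> forall c, L_fun B c = 0 -> c = 0.
Proof.
rewrite -(dim_hermcoord R r) dim_limgP.
by split=> inj c; have := inj c; rewrite L_opE.
Qed.

Lemma rank_A_tildeP m r (B : 'M[C]_(m, r)) :
  \rank (A_tilde B) = (r ^ 2)%N <-> forall c, L_fun B c = 0 -> c = 0.
Proof.
rewrite -(A_tilde_width r) rank_colP; split=> [inj c Lc|inj x].
  by apply: col_of_coord_eq0; apply: inj; rewrite A_tilde_mul.
have [c <-] := col_of_coord_surj x; rewrite A_tilde_mul => /inj ->.
rewrite /col_of_coord; apply/eqP; rewrite !col_mx_eq0.
by apply/and3P; split; apply/eqP/colP => k; rewrite !mxE ffunE.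
Qed.

End Ranks.

(** * Extremality and the two rank conditions *)

Theorem theorem2p8 (R : realType) (n m r : nat) (hm : (m <= n)%N)
    (hr : (r <= n)%N) (T A : 'M[R[i]]_n) (lam : r.-tuple R) :
  A_1_infty T ->
  \rank T = r ->
  (forall i : 'I_n, (i < m)%N -> T i i = 1) ->
  (forall i : 'I_n, (m <= i)%N -> T i i < 1) ->
  A \is unitarymx ->
  sorted >=%R lam ->
  all (fun x : R => 0 < x) lam ->
  T = A *m diag_mx (\row_(i < n) (lam`_i)%:C) *m A^t* ->
  (extreme_point (@A_1_infty R n) T <->
     \dim (limg (L_op (topleft hm hr A))) = (r ^ 2)%N) /\
  (\dim (limg (L_op (topleft hm hr A))) = (r ^ 2)%N <->
     \rank (A_tilde (topleft hm hr A)) = (r ^ 2)%N).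
Proof.
move=> TA _ T_tight T_slack A_unitary _ l_gt0 T_spectral.
rewrite dim_limg_L_opP rank_A_tildeP; split=> //.
(* [B] keeps all [n] rows, as the spectral formula for [T] requires; [topleft] keeps only the [m]
   tight ones. *)
pose B := colsub (widen_ord hr) A.
have LE c : L_fun (topleft hm hr A) c = 0 <->
    forall i : 'I_n, (i < m)%N -> L_fun B c i 0 = 0.
  have row s : L_fun (topleft hm hr A) c s 0 = L_fun B c (widen_ord hm s) 0.
    by rewrite !mxE; congr (_ + _); apply: eq_bigr => k _; rewrite !mxE.
  split=> [/colP L0 i im|L0].
    have -> : i = widen_ord hm (Ordinal im) by exact: val_inj.
    by rewrite -row L0 mxE.
  by apply/colP => s; rewrite row L0 ?mxE/=.
have B_isometry : B^t* *m B = 1%:M.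
  (* [unitarymx] speaks of rows; [A] is square, so its columns are orthonormal as well. *)
  have /matrixP AA : A^t* *m A = 1%:M by apply: mulmx1C; exact/unitarymxP.
  apply/matrixP => i j; have := AA (widen_ord hr i) (widen_ord hr j).
  rewrite !mxE -!val_eqE /= => <-.
  by apply: eq_bigr => k _; rewrite !mxE.
have l0 k : 0 < lam`_(k : 'I_r) by apply: (allP l_gt0); rewrite mem_nth ?size_tuple.
have TB : T = B *m diag_mx (\row_(k < r) (lam`_k)%:C) *m B^t*.
  rewrite T_spectral !mul_mx_diag; apply/matrixP => i j; rewrite !mxE.
  (* Past position [r] the tuple [lam] returns the default 0, so the remaining columns of [A] drop
     out. *)
  rewrite (bigID (fun k : 'I_n => (k < r)%N)) /= [X in _ + X]big1 => [|k rk].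
    by rewrite addr0 (big_ord_narrow hr); apply: eq_bigr => k _; rewrite !mxE.
  have lk0 : lam`_k = 0 by rewrite nth_default// size_tuple leqNgt.
  by rewrite !mxE lk0 rmorph0 mulr0 mul0r.
split=> [ext c /LE|inj].
  exact: (extreme_point_L_inj T_tight T_slack B_isometry l0 TB).
have injB c : (forall i : 'I_n, (i < m)%N -> L_fun B c i 0 = 0) -> c = 0.
  by move=> /LE/inj.
split=> // Y Z t YA ZA t01 TE; split.
  exact: (L_inj_convex_eq T_tight B_isometry TB injB YA ZA t01 TE).
(* The second endpoint follows by exchanging [Y] and [Z]. *)
have s01 : 0 < 1 - t < 1 by lra.
apply: (L_inj_convex_eq T_tight B_isometry TB injB ZA YA s01).
by rewrite TE addrC subKr.
Qed.
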